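(* Let $p_1,\dots,p_\ell$ ($\ell\ge1$) be distinct primes, $m=p_1\cdots p_\ell$, and let $G=\mathbb{Z}/p_1\times\cdots\times\mathbb{Z}/p_\ell$ (cyclic of order $m$) act linearly on $\mathbb{Z}^n$. For each $l\geq 0$, $$\operatorname{rank}_{\mathbb{Z}}(H^l(\mathbb{Z}^n\rtimes G))=\mathsf{H}(l,m,\mathbb{Z}^n).$$
   Context: $H^*$ denotes group cohomology with untwisted integer coefficients. For a $\mathbb{Z}[G]$-lattice $M$ (a finitely generated $\mathbb{Z}[G]$-module that is free over $\mathbb{Z}$), an integer $l\ge 0$ and a positive divisor $d$ of $m$, the integer $\mathsf{H}(l,d,M)$ is defined as follows. If $l>\operatorname{rank}_{\mathbb{Z}}(M)$, $\mathsf{H}(l,d,M)=0$. If $l\leq\operatorname{rank}_{\mathbb{Z}}(M)$, let $\mathbf{x}$ be the vector of all complex eigenvalues, including multiplicities, of a generator $g$ of $G$ acting on $M$, and let $\wedge^l\mathbf{x}$ be the vector whose coordinates are all $\binom{\operatorname{rank}_{\mathbb{Z}}(M)}{l}$ products of collections of $l$ coordinates of $\mathbf{x}$ (the eigenvalues of the $l$-th exterior power of $g$). Then $\mathsf{H}(l,d,M)$ is the number of coordinates of $\wedge^l\mathbf{x}$ that are $\frac{m}{d}$-th roots of unity (for $d=m$: the number of coordinates equal to $1$). *)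

(* Defs.v *)
From HB Require Import structures.
From mathcomp Require Import all_boot all_order all_fingroup all_algebra all_character.
From mathcomp Require Import boolp classical_sets functions reals.
From mathcomp Require Import ring_quotient.
From mathcomp Require Import complex.

Set Implicit Arguments.
Unset Strict Implicit.
Unset Printing Implicit Defensive.

Import GRing.Theory Num.Theory.
Import Quotient.
Local Open Scope ring_scope.

(* Cohomology of a possibly infinite group with trivial coefficients in int,
   computed by the homogeneous bar complex: the l-cochains are the functions
   Gamma^(l+1) -> int that are invariant under diagonal left translation.
   Arbitrary functions form the zmodType [cochain]; invariance is imposed both
   on the cocycles and on the cochains whose coboundaries are divided out. *)
Section GroupCohomology.
Variable Gamma : groupType.

Definition cochain (l : nat) : Type := ('I_l.+1 -> Gamma) -> int.
HB.instance Definition _ l := GRing.Zmodule.on (cochain l).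

Definition invariant_cochain l (f : cochain l) : Prop :=
  forall (a : Gamma) (x : 'I_l.+1 -> Gamma), f (fun j => (a * x j)%g) = f x.

(* [x \o lift i] is the tuple x with its i-th entry omitted. *)
Definition coboundary l (f : cochain l) : cochain l.+1 :=
  fun x => \sum_(i < l.+2) (-1) ^+ i * f (x \o lift i).

Definition cocycle_pred l : pred (cochain l) :=
  fun f => `[< invariant_cochain f /\ coboundary f = 0 >].

Definition is_coboundary l : cochain l -> Prop :=
  match l with
  | 0 => fun f => f = 0
  | l'.+1 => fun f =>
      exists2 h : cochain l', invariant_cochain h & f = coboundary h
  end.

Lemma invariant_cochainB l (f g : cochain l) :
  invariant_cochain f -> invariant_cochain g -> invariant_cochain (f - g).
Proof.
by move=> fi gi a x; have /= := fi a x; have := gi a x; rewrite /= !fctE => -> ->.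
Qed.

Lemma coboundaryB l (f g : cochain l) :
  coboundary (f - g) = coboundary f - coboundary g.
Proof.
apply/funext => x; rewrite /coboundary !fctE -sumrB.
by apply: eq_bigr => i _; rewrite mulrBr.
Qed.

Lemma coboundary0 l : coboundary (0 : cochain l) = 0.
Proof. by rewrite -[X in coboundary X](subrr 0) coboundaryB subrr. Qed.

Lemma cocycle_zmod_closed l : zmod_closed (@cocycle_pred l).
Proof.
split; first by apply/asboolP; split; [move=> a x | exact: coboundary0].
move=> f g /asboolP[fi df] /asboolP[gi dg]; apply/asboolP; split.
  exact: invariant_cochainB.
by rewrite coboundaryB df dg subrr.
Qed.
HB.instance Definition _ l :=
  GRing.isZmodClosed.Build (cochain l) (@cocycle_pred l)
    (@cocycle_zmod_closed l).

Record cocycle l := Cocycle {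
  cocycle_val :> cochain l;
  _ : cocycle_val \in @cocycle_pred l }.
HB.instance Definition _ l := [isSub for @cocycle_val l].
HB.instance Definition _ l := [Choice of cocycle l by <:].
HB.instance Definition _ l := [SubChoice_isSubZmodule of cocycle l by <:].

Definition coboundary_pred l : pred (cocycle l) :=
  fun f => `[< is_coboundary (val f) >].

Lemma coboundary_zmod_closed l : zmod_closed (@coboundary_pred l).
Proof.
case: l => [|l]; split.
- exact/asboolP.
- by move=> f g /asboolP/= f0 /asboolP/= g0; apply/asboolP; rewrite /= f0 g0 subrr.
- apply/asboolP; exists 0; [by move=> a x | by rewrite coboundary0].
- move=> f g /asboolP[/= f' fi fE] /asboolP[/= g' gi gE]; apply/asboolP.
  exists (f' - g'); first exact: invariant_cochainB.
  by rewrite coboundaryB -fE -gE.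
Qed.
HB.instance Definition _ l :=
  GRing.isZmodClosed.Build (cocycle l) (@coboundary_pred l)
    (@coboundary_zmod_closed l).

Definition cohomology l : zmodType :=
  {quot (GRing.ZmodClosed.clone (cocycle l) (@coboundary_pred l) _)}.

End GroupCohomology.

Section Rank.
Variable A : zmodType.

Definition int_free r (v : 'I_r -> A) : Prop :=
  forall c : 'I_r -> int, \sum_i v i *~ c i = 0 -> forall i, c i = 0.

(* r is the maximal cardinality of a Z-linearly independent family in A. *)
Definition has_rank (r : nat) : Prop :=
  (exists v : 'I_r -> A, int_free v) /\ (forall v : 'I_r.+1 -> A, ~ int_free v).

End Rank.

(* Z^n ><| G for G acting by rho on column vectors from the left:
   (v, a) (w, b) = (v + rho(a) w, ab). *)
Definition semidirect (gT : finGroupType) n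
  (rho : mx_representation int [set: gT] n) : Type := 'cV[int]_n * gT.

Section SemidirectProduct.
Variables (gT : finGroupType) (n : nat).
Variable rho : mx_representation int [set: gT] n.

Local Notation semidirect := (semidirect rho).
HB.instance Definition _ := Choice.on semidirect.

Implicit Types x y : semidirect.

Definition semidirect_one : semidirect := (0, 1%g).
Definition semidirect_mul x y : semidirect :=
  (x.1 + rho x.2 *m y.1, (x.2 * y.2)%g).
Definition semidirect_inv x : semidirect :=
  (- (rho x.2^-1%g *m x.1), x.2^-1%g).

Lemma semidirect_mulA : associative semidirect_mul.
Proof.
move=> [u a] [v b] [w c]; rewrite /semidirect_mul /= mulgA repr_mxM ?inE //.
by rewrite mulmxDr mulmxA addrA.
Qed.

Lemma semidirect_mul1 : left_id semidirect_one semidirect_mul.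
Proof. by move=> [u a]; rewrite /semidirect_mul /= mul1g repr_mx1 mul1mx add0r. Qed.

Lemma semidirect_mulr1 : right_id semidirect_one semidirect_mul.
Proof. by move=> [u a]; rewrite /semidirect_mul /= mulg1 mulmx0 addr0. Qed.

Lemma semidirect_mulV : left_inverse semidirect_one semidirect_inv semidirect_mul.
Proof. by move=> [u a]; rewrite /semidirect_mul /= mulVg addNr. Qed.

Lemma semidirect_mulrV : right_inverse semidirect_one semidirect_inv semidirect_mul.
Proof.
move=> [u a]; rewrite /semidirect_mul /= mulgV mulmxN mulmxA.
by rewrite -repr_mxM ?inE // mulgV repr_mx1 mul1mx subrr.
Qed.

HB.instance Definition _ := isGroup.Build semidirect
  semidirect_mulA semidirect_mul1 semidirect_mulr1
  semidirect_mulV semidirect_mulrV.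

End SemidirectProduct.

Section EigenvalueCount.
Variable R : realType.

(* The roots of the characteristic polynomial, repeated with multiplicity. *)
Definition eigenvalues n (A : 'M[R[i]]_n) : seq R[i] :=
  sval (closed_field_poly_normal (char_poly A)).

Lemma size_eigenvalues n (A : 'M[R[i]]_n) : size (eigenvalues A) = n.
Proof.
rewrite /eigenvalues; case: closed_field_poly_normal => s /= sE.
have /monicP l1 := char_poly_monic A; apply: succn_inj.
by rewrite -(size_char_poly A) sE l1 scale1r size_prod_XsubC.
Qed.

Definition wedge l (x : seq R[i]) : seq R[i] :=
  [seq \prod_(i in J) x`_i
     | J : {set 'I_(size x)} <- enum [set J : {set 'I_(size x)} | #|J| == l]].

(* H(l, d, M) for M = Z^n on which a generator of the cyclic group of order m
   acts by A. *)
Definition Hcount (m l d n : nat) (A : 'M[int]_n) : nat :=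
  if (l <= n)%N then
    count (m %/ d).-unity_root
      (wedge l (eigenvalues (map_mx intr A : 'M[R[i]]_n)))
  else 0%N.

End EigenvalueCount.

(* Z/p_1 x ... x Z/p_ell; 'Z_(p i) is Z/p_i as soon as p_i > 1. *)
Definition prod_Zp ell (p : 'I_ell -> nat) : finGroupType :=
  {dffun forall i, 'Z_(p i)}.

(* Main.v *)
Require Import Defs.
From HB Require Import structures.
From mathcomp Require Import all_boot all_order all_fingroup all_solvable.
From mathcomp Require Import all_algebra all_field all_character.
From mathcomp Require Import boolp functions reals complex.
From mathcomp Require Import generic_quotient ring_quotient.
From mathcomp Require Import zify ring.

(** Let L = Z^n, acting on Gamma = L ><| G by left translation. Contracting an
    L-invariant cocycle f against basis vectors e_j1, ..., e_jl (that is,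
    evaluating it on the torus cycle they span) gives integers r_J(f), the
    periods of f. Each contraction is a chain homotopy between the identity and
    a translation, so the periods of coboundaries vanish; conversely, adding one
    generator of L at a time as in the Wang sequence, an L-invariant cocycle all
    of whose periods vanish is the coboundary of an L-invariant cochain.
    An alternating form w on L yields the L-invariant cocycle
    w(v1 - v0, ..., vl - v(l-1)), whose periods are l! w(e_J). Hence l! f is
    cohomologous over L to the cocycle of its periods; if f is Gamma-invariant
    its periods are therefore G-invariant, and averaging over G shows that f is
    torsion in H^l(Gamma) when they vanish. So H^l(Gamma) has the rank of the
    lattice of G-invariant alternating l-forms, which is the kernel of
    (compound matrix of rho(g)) - 1; diagonalizing rho(g) over the complex
    numbers, the dimension of this kernel is the number of l-subsets of the
    eigenvalues with product 1. *)

Set Implicit Arguments.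
Unset Strict Implicit.
Unset Printing Implicit Defensive.

Import GRing.Theory Num.Theory.
Local Open Scope ring_scope.

(** * Cochains as functions on lists, in all degrees at once *)

Section ListCochains.
Variables (n : nat) (X : Type).
Variables (act : 'cV[int]_n -> X -> X) (pos : X -> 'cV[int]_n).
Hypothesis act0 : forall x, act 0 x = x.
Hypothesis actD : forall u v x, act (u + v) x = act u (act v x).
Hypothesis pos_act : forall v x, pos (act v x) = v + pos x.
Variable x0 : X.

Implicit Types (F h : seq X -> int) (s : seq X) (v : 'cV[int]_n).

(* The differential of the augmented bar complex. *)
Fixpoint diff F s : int :=
  if s is x :: s' then F s' - diff (fun u => F (x :: u)) s' else 0.

(* The prism operator: the alternating sum over i of the values of F at
   (x_0, ..., x_i, v x_i, ..., v x_l). *)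
Fixpoint contract v F s : int :=
  if s is x :: s'
  then F (x :: map (act v) s) - contract v (fun u => F (x :: u)) s' else 0.

Definition trans v F s := F (map (act v) s).

Lemma diff_lin a b F h s :
  diff (fun u => a * F u + b * h u) s = a * diff F s + b * diff h s.
Proof.
elim: s F h => [|x s IHs] F h /=; first by rewrite !mulr0 addr0.
by rewrite IHs; ring.
Qed.

Lemma contract_lin v a b F h s :
  contract v (fun u => a * F u + b * h u) s
    = a * contract v F s + b * contract v h s.
Proof.
elim: s F h => [|x s IHs] F h /=; first by rewrite !mulr0 addr0.
by rewrite IHs; ring.
Qed.

Lemma diff_sub F h s : diff (fun u => F u - h u) s = diff F s - diff h s.
Proof.
rewrite -[RHS]/(_ + - _) -mulN1r -[X in X + _]mul1r -diff_lin.
by congr diff; apply/funext => u; rewrite mul1r mulN1r.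
Qed.

Lemma diff_diff F s : diff (diff F) s = 0.
Proof.
elim: s F => //= x s IHs F.
by rewrite diff_sub IHs subr0 subrr.
Qed.

Lemma diff_map (p : X -> X) F s :
  diff (fun u => F (map p u)) s = diff F (map p s).
Proof. by elim: s F => //= x s IHs F; rewrite -IHs. Qed.

(** By induction on [s]: the terms in which [x] is followed by [act v x] cancel, and what remains is
    the identity for [fun u => F (x :: u)] on the tail. *)
Lemma prism v F s :
  diff (contract v F) s + contract v (diff F) s = trans v F s - F s.
Proof.
elim: s F => [|x s IHs] F /=; first by rewrite addr0 /trans subrr.
have E1 : diff (fun u => F (x :: act v x :: [seq act v i | i <- u])
      - contract v (fun u0 => F (x :: u0)) u) s
  = diff (fun u => F (x :: act v x :: u)) (map (act v) s)
    - diff (contract v (fun u0 => F (x :: u0))) s.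
  by rewrite diff_sub (diff_map _ (fun u => F (x :: act v x :: u))).
have E2 : contract v (fun u => F u - diff (fun u0 => F (x :: u0)) u) s
  = contract v F s - contract v (diff (fun u0 => F (x :: u0))) s.
  rewrite -[RHS]/(_ + - _) -mulN1r -[X in X + _]mul1r -contract_lin.
  by congr contract; apply/funext => u; rewrite mul1r mulN1r.
rewrite E1 E2; have := IHs (fun u => F (x :: u)); rewrite /trans /= => IH.
have -> : diff (contract v (fun u => F (x :: u))) s
    = F (x :: map (act v) s) - F (x :: s)
      - contract v (diff (fun u => F (x :: u))) s by rewrite -IH addrK.
ring.
Qed.

Definition invariant_under v F := forall s, trans v F s = F s.

Lemma map_actC u v s :
  map (act u) (map (act v) s) = map (act v) (map (act u) s).
Proof.
by rewrite -!map_comp; apply: eq_map => x /=; rewrite -!actD addrC.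
Qed.

Lemma contract_trans u v F s :
  contract v (trans u F) s = trans u (contract v F) s.
Proof.
rewrite /trans; elim: s F => //= x s IHs F.
by rewrite -(IHs (fun w => F (act u x :: w))) map_actC -!actD (addrC u).
Qed.

Lemma contract_inv u v F :
  invariant_under u F -> invariant_under u (contract v F).
Proof.
by move=> iF s; rewrite -contract_trans; congr contract; apply/funext.
Qed.

Lemma diff_inv v F : invariant_under v F -> invariant_under v (diff F).
Proof.
move=> iF s; rewrite /trans -diff_map.
by congr diff; apply/funext => u; apply: iF.
Qed.

Local Notation e i := (delta_mx i 0 : 'cV[int]_n).

(** The head of [js] is contracted first, so a decreasing list starts with its largest index, the
    generator that [cocycle_exact] adds last. *)
Definition contracts (js : seq 'I_n) F :=
  foldl (fun F j => contract (e j) F) F js.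

Lemma contracts_lin js a b F h s :
  contracts js (fun u => a * F u + b * h u) s
    = a * contracts js F s + b * contracts js h s.
Proof.
elim: js F h => //= j js IHjs F h.
by rewrite -IHjs; congr contracts; apply/funext => u; rewrite contract_lin.
Qed.

(** By the prism identity, contraction along a translation that fixes [h] anticommutes with [diff].
    Once all contractions are moved inside, [diff] at a singleton only reads a value at the empty
    list, which is 0. *)
Lemma contracts_diff js h : h [::] = 0 ->
  (forall j, j \in js -> invariant_under (e j) h) ->
  contracts js (diff h) [:: x0] = 0.
Proof.
elim: js h => [|j js IHjs] h h0 ih /=; first by rewrite h0 subrr.
have -> : contract (e j) (diff h)
    = (fun u => (-1) * diff (contract (e j) h) u + 0 * 0).
  apply/funext => u; have := prism (e j) h u.
  rewrite ih ?mem_head // subrr mulr0 addr0 mulN1r => /eqP.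
  by rewrite addrC addr_eq0 => /eqP.
rewrite (contracts_lin js (-1) 0 _ (fun=> 0)) mul0r addr0 IHjs ?mulr0 //.
by move=> i ijs; apply: contract_inv; apply: ih; rewrite in_cons ijs orbT.
Qed.

(** The discrete antiderivative of [a] vanishing at 0; for negative [z] it is minus the sum of [a]
    from [z] to -1. *)
Definition int_sum (a : int -> int) (z : int) : int :=
  match z with
  | Posz m => \sum_(i < m) a i
  | Negz m => - \sum_(i < m.+1) a (Negz i)
  end.

Lemma int_sumS a z : int_sum a (z + 1) = int_sum a z + a z.
Proof.
case: z => [m|m]; first by rewrite -PoszD addn1 /= big_ord_recr.
case: m => [|m]; first by rewrite /= big_ord_recl !big_ord0 addr0 addNr.
have -> : Negz m.+1 + 1 = Negz m by lia.
by rewrite /= [in RHS]big_ord_recr /= opprD subrK.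
Qed.

(* Translation by [e k] is free: sum [h] along its orbits, starting from the
   points whose head has [k]-th coordinate 0. *)
Lemma trans_sub_surj (k : 'I_n) h : h [::] = 0 ->
  (forall i : 'I_n, (i < k)%N -> invariant_under (e i) h) ->
  exists h', [/\ h' [::] = 0,
      forall i : 'I_n, (i < k)%N -> invariant_under (e i) h'
    & forall s, trans (e k) h' s - h' s = h s].
Proof.
move=> h0 ih.
pose h' s := if s is x :: _ then
    let z := pos x k 0 in
    int_sum (fun j => h (map (act ((j - z) *: e k)) s)) z else 0.
exists h'; split=> //.
- move=> i ik [|x s] //; rewrite /trans /h' map_cons; cbv zeta.
  have -> : pos (act (e i) x) k 0 = pos x k 0.
    rewrite pos_act !mxE eqxx andbT.
    by case: eqVneq ik => [->|_ _]; rewrite ?ltnn // add0r.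
  congr int_sum; apply/funext => j.
  by rewrite -[act (e i) x :: _]/(map (act (e i)) (x :: s)) map_actC; apply: ih.
- move=> [|x s]; first by rewrite /trans /= h0 subrr.
  rewrite /trans /h' map_cons; cbv zeta.
  have -> : pos (act (e k) x) k 0 = pos x k 0 + 1.
    by rewrite pos_act !mxE !eqxx addrC.
  (* The shift [j - z] absorbs the translation, so both sums have the same summands; the extra one,
     at the old coordinate of the head, is [h s]. *)
  rewrite int_sumS addrAC -[act (e k) x :: _]/(map (act (e k)) (x :: s)).
  set S1 := int_sum _ _; set S2 := int_sum _ _.
  have -> : S1 = S2.
    congr int_sum; apply/funext => j; rewrite -map_comp.
    congr h; apply: eq_map => y /=; rewrite -actD -{2}[e k]scale1r -scalerDl.
    by congr (act (_ *: _)); ring.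
  rewrite subrr add0r -map_comp; congr h; rewrite -[RHS]map_id.
  apply: eq_map => y /=; rewrite -actD -{2}[e k]scale1r -scalerDl.
  by rewrite opprD addrA subrr sub0r addNr scale0r act0.
Qed.

(* If [F = diff h] with [h] invariant under the first k generators and t is the
   next one, then [w := trans t h - h] is a cocycle that differs from
   [contract t F] by a coboundary, so that [w = diff (trans t k2 - k2)] for some
   [k2] by induction; [h - diff k2] is then t-invariant. *)
Lemma cocycle_exact k F : (k <= n)%N ->
  F [::] = 0 -> (forall s, diff F s = 0) ->
  (forall i : 'I_n, (i < k)%N -> invariant_under (e i) F) ->
  (forall js, sorted gtn (map val js) -> all (fun j : 'I_n => j < k)%N js ->
     contracts js F [:: x0] = 0) ->
  exists h, [/\ h [::] = 0,
      forall i : 'I_n, (i < k)%N -> invariant_under (e i) h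
    & forall s, diff h s = F s].
Proof.
elim: k F => [|k IHk] F kn F0 dF iF rF.
  (* With no invariance to respect, the cone with apex [x0] is a primitive. The condition for the
     empty list of contractions says that it vanishes at the empty list. *)
  exists (fun u => F (x0 :: u)); split=> // [|s]; first exact: (rF [::]).
  by have /eqP := dF (x0 :: s); rewrite /= subr_eq0 => /eqP.
pose t := Ordinal kn.
have [||h [h0 ih dh]] := IHk F (ltnW kn) F0 dF.
- by move=> i ik; apply: iF; apply: ltnW.
- move=> js js1 js2; apply: rF => //.
  by apply: sub_all js2 => j /= jk; apply: ltnW.
have dFh : diff h = F by apply/funext.
pose w s := trans (e t) h s - h s.
have w0 : w [::] = 0 by rewrite /w /trans /= subrr.
have wE : w = (fun u => 1 * diff (contract (e t) h) u + 1 * contract (e t) F u).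
  by apply/funext => u; rewrite !mul1r -dFh prism.
have [|||k1 [k10 ik1 dk1]] := IHk w (ltnW kn) w0.
- move=> s; rewrite /w diff_sub [X in X - _]diff_map dFh.
  by rewrite [X in X - _]iF ?subrr //=.
- move=> i ik s; rewrite /w /trans map_actC.
  by congr (_ - _); apply: ih.
(* The periods of [w] along [js] are those of [F] along [t :: js], which is again decreasing because
   [js] lies below [t]. *)
- move=> js js1 js2; rewrite wE contracts_lin !mul1r contracts_diff //; last first.
    by move=> j jjs; apply: contract_inv; apply: ih; apply: (allP js2).
  rewrite add0r -[LHS]/(contracts (t :: js) F [:: x0]); apply: rF.
    rewrite /= path_min_sorted //.
    by apply/allP => _ /mapP[j jjs ->] /=; apply: (allP js2).
  rewrite /= ltnSn; apply: sub_all js2 => j /= jk; exact: ltnW.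
have [k2 [k20 ik2 dk2]] := trans_sub_surj (k := t) k10 ik1.
exists (fun s => h s - diff k2 s); split.
- by rewrite h0 subr0.
- move=> i; rewrite ltnS leq_eqVlt => /orP[/eqP ik|ik]; last first.
    move=> s; rewrite /trans; congr (_ - _); first exact: ih.
    by apply: diff_inv; apply: ik2.
  have -> : i = t by apply: val_inj.
  move=> s; apply/eqP; rewrite -subr_eq0; apply/eqP.
  have -> : trans (e t) (fun s => h s - diff k2 s) s - (h s - diff k2 s)
     = w s - (trans (e t) (diff k2) s - diff k2 s) by rewrite /w /trans; ring.
  rewrite -dk1 [X in _ - (X - _)]/trans -diff_map -diff_sub -diff_sub.
  set z := fun _ => _; have -> : z = (fun=> 0).
    by apply/funext => u; rewrite /z -dk2 /trans subrr.
  by elim: s {w w0 wE dk1 z ik2 dk2} => //= x s IHs; rewrite IHs subrr.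
- by move=> s; rewrite diff_sub diff_diff subr0.
Qed.

End ListCochains.

(** * Cocycles from alternating forms *)

Section FormCochains.
Variables (n : nat) (X : Type).
Variables (act : 'cV[int]_n -> X -> X) (pos : X -> 'cV[int]_n).
Hypothesis pos_act : forall v x, pos (act v x) = v + pos x.

Implicit Types (w : seq 'cV[int]_n -> int) (u v : 'cV[int]_n) (s : seq X)
  (vs : seq 'cV[int]_n).

Definition multiadditive w := forall vs1 u v vs2,
  w (vs1 ++ (u + v) :: vs2) = w (vs1 ++ u :: vs2) + w (vs1 ++ v :: vs2).

Definition skew_form w := forall vs1 u v vs2,
  w (vs1 ++ u :: v :: vs2) = - w (vs1 ++ v :: u :: vs2).

Definition steps x s := pairmap (fun y z => pos z - pos y) x s.

Definition form_cochain w s : int := if s is x :: s' then w (steps x s') else 0.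

(** Omitting an entry merges two consecutive steps, and additivity splits the merged value; the
    alternating sum telescopes to the term where the step from [x] is dropped. *)
Lemma diff_steps w x s : multiadditive w ->
  diff (fun t => w (steps x t)) s = form_cochain w s.
Proof.
elim: s w x => //= y s IHs w x addw.
have -> := IHs (fun t => w ((pos y - pos x) :: t)).
  case: s {IHs} => [|z s] /=; first by rewrite subr0.
  have -> : pos z - pos x = (pos y - pos x) + (pos z - pos y).
    by rewrite [RHS]addrC addrA subrK.
  by rewrite (addw [::]) addrAC subrr add0r.
by move=> vs1; apply: (addw (_ :: vs1)).
Qed.

Lemma diff_form_cochain w s : multiadditive w -> diff (form_cochain w) s = 0.
Proof.
by case: s => //= x s addw; rewrite diff_steps ?subrr.
Qed.

Lemma steps_act v x s : steps (act v x) (map (act v) s) = steps x s.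
Proof.
elim: s x => //= y s IHs x; rewrite IHs !pos_act; congr (_ :: _).
by rewrite opprD addrACA subrr add0r.
Qed.

Lemma form_cochain_inv v w : invariant_under act v (form_cochain w).
Proof. by case=> //= x s; rewrite /trans /= steps_act. Qed.

(** Each prism term inserts the step [v] at one position. Moving it to the front produces a sign
    that offsets the alternating one, so all terms are equal. *)
Lemma contract_steps v w x s : skew_form w ->
  contract act v (fun t => w (steps x t)) s
    = - ((size s)%:Z * w (v :: steps x s)).
Proof.
elim: s w x => [|y s IHs] w x skw /=; first by rewrite mul0r oppr0.
rewrite (IHs (fun t => w ((pos y - pos x) :: t))); last first.
  by move=> vs1; apply: (skw (_ :: vs1)).
rewrite steps_act pos_act addrK !(skw [::] _ v) /= intS.
ring.
Qed.

Lemma contract_form_cochain v w s : skew_form w ->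
  contract act v (form_cochain w) s
    = (size s)%:Z * form_cochain (fun t => w (v :: t)) s.
Proof.
case: s => [|x s] skw /=; first by rewrite mul0r.
rewrite contract_steps // steps_act pos_act addrK intS.
ring.
Qed.

Lemma contract_size a v F s :
  contract act v (fun t => a (size t) * F t) s
    = a (size s).+1 * contract act v F s.
Proof.
elim: s a F => [|x s IHs] a F /=; first by rewrite mulr0.
by rewrite (IHs (fun k => a k.+1)) /= size_map mulrBr.
Qed.

Local Notation e i := (delta_mx i 0 : 'cV[int]_n).

Lemma contracts_size a js F s :
  contracts act js (fun t => a (size t) * F t) s
    = a (size s + size js)%N * contracts act js F s.
Proof.
elim: js a F => [|j js IHjs] a F /=; first by rewrite addn0.
have -> : contract act (e j) (fun t => a (size t) * F t)
    = (fun t => a (size t).+1 * contract act (e j) F t).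
  by apply/funext => t; rewrite contract_size.
by rewrite (IHjs (fun k => a k.+1)) addnS.
Qed.

(** Each contraction multiplies by the length of the list at which it is evaluated, and the first
    one sees the longest lists. From a singleton these lengths multiply to [(size js)!]. *)
Lemma contracts_form_cochain js w s : skew_form w ->
  contracts act js (form_cochain w) s
    = (\prod_(i < size js) (size s + i)%N)%:Z
      * form_cochain (fun t => w (map (fun j => e j) js ++ t)) s.
Proof.
elim: js w => [|j js IHjs] w skw /=; first by rewrite big_ord0 mul1r.
have -> : contract act (e j) (form_cochain w)
    = (fun s => (size s)%:Z * form_cochain (fun t => w (e j :: t)) s).
  by apply/funext => t; rewrite contract_form_cochain.
rewrite (contracts_size (fun k => k%:Z)) IHjs; last first.
  by move=> vs1; apply: (skw (_ :: vs1)).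
by rewrite big_ord_recr /= mulrA mulnC PoszM.
Qed.

Lemma contracts_form_base js w x : skew_form w ->
  contracts act js (form_cochain w) [:: x]
    = (size js)`!%:Z * w (map (fun j => e j) js).
Proof.
move=> skw; rewrite contracts_form_cochain //= cats0; congr (_%:Z * _).
by rewrite fact_prod big_add1 /= big_mkord.
Qed.

Lemma form_cochain_equiv (p : X -> X) (A : 'M[int]_n) w s :
  (forall x y, pos (p y) - pos (p x) = A *m (pos y - pos x)) ->
  form_cochain w (map p s) = form_cochain (fun t => w (map (mulmx A) t)) s.
Proof.
move=> pA; case: s => //= x s; congr w.
by elim: s x => //= y s IHs x; rewrite IHs pA.
Qed.

Hypothesis act0 : forall x, act 0 x = x.
Hypothesis actD : forall u v x, act (u + v) x = act u (act v x).

Lemma invariant_gen F : (forall i, invariant_under act (e i) F) ->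
  forall v, invariant_under act v F.
Proof.
move=> iF.
have i0 : invariant_under act 0 F.
  by move=> s; rewrite /trans -[in RHS](map_id s); congr F; apply: eq_map.
have iD u v : invariant_under act u F -> invariant_under act v F ->
    invariant_under act (u + v) F.
  move=> iu iv s; rewrite -[RHS]iv -[RHS]iu /trans -map_comp; congr F.
  by apply: eq_map => x /=; rewrite actD.
have iN u : invariant_under act u F -> invariant_under act (- u) F.
  move=> iu s; rewrite -[LHS]iu /trans -map_comp -[in RHS](map_id s); congr F.
  by apply: eq_map => x /=; rewrite -actD subrr.
have iZ z i : invariant_under act (z *: e i) F.
  have inat m : invariant_under act (m%:Z *: e i) F.
    elim: m => [|m IHm]; first by rewrite scale0r.
    by rewrite intS scalerDl scale1r; apply: iD.
  case: z => m //; rewrite NegzE scaleNr; exact: iN.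
move=> v; rewrite (matrix_sum_delta v).
elim/big_ind: _ => // i _; rewrite big_ord1 ord1; exact: iZ.
Qed.

End FormCochains.

(** * Compound matrices *)

(** These tuples index the [l]-subsets of ['I_n], hence the standard basis of the [l]-th exterior
    power, in the order in which [cocycle_exact] contracts. *)
Notation decreasing l n := {t : l.-tuple 'I_n | sorted gtn (map val t)}.

Section Decreasing.
Variables l n : nat.
Implicit Types t u : decreasing l n.

Lemma decreasing_inj t : injective (tnth (val t)).
Proof.
have : uniq (val t).
  rewrite -(map_inj_uniq val_inj).
  by apply: sorted_uniq (valP t) => [a b c /= /[swap]|a];
    [apply: ltn_trans|apply: ltnn].
by move/tuple_uniqP.
Qed.

(** Both tuples have [l] distinct entries, so inclusion is equality of sets, and a strictly sorted
    list is determined by its set of entries. *)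
Lemma decreasing_eq_mem t u : (forall a, tnth (val t) a \in val u) -> t = u.
Proof.
move=> tu; apply: val_inj; apply: val_inj => /=; apply: (inj_map val_inj).
have gtn_tr : transitive gtn by move=> a b c /= /[swap]; apply: ltn_trans.
have sub : {subset val t <= val u} by move=> _ /tnthP[a ->].
have ut : uniq (val t) by apply/tuple_uniqP; apply: decreasing_inj.
apply: (irr_sorted_eq gtn_tr ltnn (valP t) (valP u)).
apply: eq_mem_map; apply: (uniq_min_size ut sub _).2.
by rewrite !size_tuple.
Qed.

Lemma decreasing_perm (f : 'I_l -> 'I_n) : injective f ->
  exists t (s : 'S_l), forall a, f a = tnth (val t) (s a).
Proof.
move=> injf.
pose r := sort (fun i j : 'I_n => (j <= i)%N) (codom f).
have rE : perm_eq (codom f) r by rewrite perm_sym perm_sort.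
have sr : size r == l by rewrite -(perm_size rE) size_codom card_ord.
have ur : uniq r by rewrite -(perm_uniq rE); apply/injectiveP.
have dr : sorted gtn (map val (Tuple sr)).
  rewrite gtn_sorted_uniq_geq map_inj_uniq; last exact: val_inj.
  by rewrite ur /= sorted_map; apply: sort_sorted => i j /=; apply: leq_total.
exists (exist _ (Tuple sr) dr) => /=.
have /tuple_permP[s fE] : perm_eq [tuple f a | a < l] (Tuple sr).
  by rewrite /= -codomE.
exists s => a; have := congr1 (fun q => nth (f a) q a) fE.
by rewrite !nth_mktuple.
Qed.

End Decreasing.

(** * The Cauchy-Binet formula and functoriality of compound matrices *)

Section CauchyBinet.
Variable R : comNzRingType.

(** Multilinearity in the rows of the product gives a sum over all functions [f]. A non-injective
    [f] repeats a row of [B] and contributes 0; an injective one is uniquely a decreasing tuple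
    composed with a permutation, and summing over permutations rebuilds the minor of [A]. *)
Lemma cauchy_binet l n (A : 'M[R]_(l, n)) (B : 'M[R]_(n, l)) :
  \det (A *m B) = \sum_(t : decreasing l n)
    \det (colsub (tnth (val t)) A) * \det (rowsub (tnth (val t)) B).
Proof.
pose G (f : {ffun 'I_l -> 'I_n}) := \prod_a A a (f a) * \det (rowsub f B).
have -> : \det (A *m B) = \sum_f G f.
  rewrite /determinant.
  under eq_bigr => s _ do under eq_bigr => a _ do rewrite mxE.
  under eq_bigr => s _ do rewrite bigA_distr_bigA mulr_sumr.
  rewrite exchange_big; apply: eq_bigr => f _ /=.
  rewrite /G /determinant mulr_sumr; apply: eq_bigr => s _.
  rewrite big_split /= mulrCA; congr (_ * (_ * _)).
  by apply: eq_bigr => a _; rewrite mxE.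
pose h (q : decreasing l n * 'S_l) := [ffun a => tnth (val q.1) (q.2 a)].
have h_inj : injective h.
  move=> [t s] [u r] /ffunP E.
  have Et : t = u.
    apply: decreasing_eq_mem => a; have := E ((s^-1)%g a).
    by rewrite !ffunE /= permKV => ->; apply: mem_tnth.
  rewrite -{u}Et in E *; congr pair; apply/permP => a.
  by have := E a; rewrite !ffunE /=; apply: decreasing_inj.
rewrite (bigID (mem (h @: setT))) /= [X in _ + X]big1 ?addr0; last first.
  move=> f fh; rewrite /G; case: (boolP (injectiveb f)) => [/injectiveP fi|].
    have [t [s fE]] := decreasing_perm fi.
    case/imsetP: fh; exists (t, s) => //.
    by apply/ffunP => a; rewrite ffunE fE.
  move=> /injectivePn[a [b ab fab]].
  rewrite (determinant_alternate ab) ?mulr0 // => c.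
  by rewrite !mxE fab.
rewrite big_imset /=; last by move=> q r _ _; apply: h_inj.
rewrite (eq_bigl predT) => [|q]; last by rewrite inE.
rewrite -(pair_bigA _ (fun t s => G (h (t, s)))) /=; apply: eq_bigr => t _.
rewrite /(\det (colsub _ _)) mulr_suml; apply: eq_bigr => s _.
have -> : G (h (t, s)) = \prod_a A a (tnth (val t) (s a))
    * \det (perm_mx s *m rowsub (tnth (val t)) B).
  rewrite /G -row_permE; congr (_ * _).
    by apply: eq_bigr => a _; rewrite ffunE.
  by congr (\det _); apply/matrixP => a b; rewrite !mxE ffunE.
rewrite det_mulmx det_perm mulrCA mulrA; congr (_ * _ * _).
by apply: eq_bigr => a _; rewrite mxE.
Qed.

(** The matrix of the [l]-th exterior power of [A]. *)
Definition compound l n (A : 'M[R]_n) : 'M[R]_#|{: decreasing l n}| :=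
  \matrix_(i, j)
    \det (mxsub (tnth (val (enum_val i))) (tnth (val (enum_val j))) A).

Lemma compoundM l n (A B : 'M[R]_n) :
  compound l (A *m B) = compound l A *m compound l B.
Proof.
apply/matrixP => i j; rewrite !mxE mxsub_mul cauchy_binet.
rewrite (reindex (enum_val (A := {: decreasing l n}))) /=; last first.
  exact/onW_bij/enum_val_bij.
by apply: eq_bigr => k _; rewrite !mxE -!mxsub_comp.
Qed.

Lemma compound_diag l n (d : 'rV[R]_n) : compound l (diag_mx d)
  = diag_mx (\row_i \prod_a d 0 (tnth (val (enum_val i)) a)).
Proof.
apply/matrixP => i j; rewrite !mxE; set t := enum_val i; set u := enum_val j.
have [ij|ij] := eqVneq i j.
  have -> : mxsub (tnth (val t)) (tnth (val u)) (diag_mx d)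
      = diag_mx (\row_a d 0 (tnth (val t) a)).
    apply/matrixP => a b; rewrite !mxE /u -ij -/t.
    by rewrite (inj_eq (@decreasing_inj _ _ t)).
  rewrite det_diag mulr1n; apply: eq_bigr => a _; by rewrite mxE.
(* Distinct tuples differ as sets, so the minor has a zero row. *)
have [a tu] : exists a, tnth (val t) a \notin val u.
  apply/existsP; rewrite -negb_forall; apply: contra ij => /forallP tu.
  apply/eqP/enum_val_inj; exact: decreasing_eq_mem.
rewrite (expand_det_row _ a) big1 // => b _.
rewrite !mxE; case: eqP => [E|_]; last by rewrite mulr0n mul0r.
by rewrite E mem_tnth in tu.
Qed.

Lemma compound1 l n : compound l (1%:M : 'M[R]_n) = 1%:M.
Proof.
rewrite -diag_const_mx compound_diag -diag_const_mx; congr diag_mx.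
by apply/rowP => i; rewrite !mxE big1 // => a _; rewrite mxE.
Qed.

End CauchyBinet.

(** * Alternating forms as integer combinations of minors *)

Section MinorForm.
Variables l n : nat.
Local Notation N := #|{: decreasing l n}|.
Implicit Types (c : 'rV[int]_N) (vs : seq 'cV[int]_n).

Definition rows_mx vs : 'M[int]_(l, n) := \matrix_(b, k) nth 0 vs b k 0.

(** The alternating form with coordinates [c], extended by 0 to lists of length other than [l] so
    that its cochain is concentrated in degree [l]. *)
Definition minor_form c vs : int :=
  if size vs == l then
    \sum_i c 0 i * \det (colsub (tnth (val (enum_val i))) (rows_mx vs))
  else 0.

Lemma minor_form_multiadditive c : multiadditive (minor_form c).
Proof.
move=> vs1 u v vs2; rewrite /minor_form !size_cat /=.
case: eqP => [sl|_]; last by rewrite addr0.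
rewrite -big_split /=; apply: eq_bigr => i _; rewrite -mulrDr; congr (_ * _).
have b0P : (size vs1 < l)%N by rewrite -sl addnS ltnS leq_addr.
pose b0 := Ordinal b0P; rewrite -[X in _ = X + _]mul1r -[X in _ = _ + X]mul1r.
apply: (determinant_multilinear (i0 := b0)).
- by apply/rowP => a; rewrite !mxE !nth_cat ltnn subnn /= !mul1r !mxE.
- apply/matrixP => b a; rewrite !mxE !nth_cat.
  case: ltnP => // bs; case E: (lift b0 b - size vs1)%N => //.
  have /eqP := neq_lift b0 b; case; apply: val_inj => /=.
  by move: bs E => /=; lia.
- apply/matrixP => b a; rewrite !mxE !nth_cat.
  case: ltnP => // bs; case E: (lift b0 b - size vs1)%N => //.
  have /eqP := neq_lift b0 b; case; apply: val_inj => /=.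
  by move: bs E => /=; lia.
Qed.

Lemma minor_form_skew c : skew_form (minor_form c).
Proof.
move=> vs1 u v vs2; rewrite /minor_form !size_cat /=.
case: eqP => [sl|_]; last by rewrite oppr0.
rewrite -sumrN; apply: eq_bigr => i _; rewrite -mulrN; congr (_ * _).
have b0P : (size vs1 < l)%N by rewrite -sl !addnS ltnS ltnW // ltnS leq_addr.
have b1P : ((size vs1).+1 < l)%N by rewrite -sl !addnS !ltnS leq_addr.
pose b0 := Ordinal b0P; pose b1 := Ordinal b1P.
have b01 : b0 != b1 by rewrite -val_eqE /= neq_ltn ltnSn.
set A := colsub _ _; set B := colsub _ _.
have -> : A = xrow b0 b1 B.
  apply/matrixP => b a; rewrite !mxE !nth_cat.
  case: tpermP => [->|->|/eqP nb0 /eqP nb1] /=.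
  - by rewrite ltnn subnn ltnNge leqnSn /= subSnn.
  - by rewrite ltnn subnn ltnNge leqnSn /= subSnn.
  - move: nb0 nb1; rewrite -!val_eqE /= => nb0 nb1; case: ltnP => // bs.
    by case E: (b - size vs1)%N => [|[|]] //; move: bs E nb0 nb1; lia.
by rewrite xrowE det_mulmx det_perm odd_tperm b01 expr1 mulN1r.
Qed.

Lemma minor_form_basis c (i : 'I_N) :
  minor_form c (map (fun j => delta_mx j 0) (val (enum_val i))) = c 0 i.
Proof.
rewrite /minor_form size_map size_tuple eqxx.
(* The minors of a list of basis vectors are entries of the compound of the identity, which is the
   identity. *)
transitivity (\sum_j c 0 j * (compound l (1%:M : 'M[int]_n)) i j).
  apply: eq_bigr => j _; rewrite mxE; congr (_ * _); congr (\det _).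
  apply/matrixP => b a; rewrite !mxE.
  rewrite (nth_map (tnth (val (enum_val i)) b)) ?size_tuple //.
  by rewrite -tnth_nth !mxE eqxx andbT eq_sym.
rewrite compound1 (bigD1 i) //= mxE eqxx mulr1 big1 ?addr0 // => j ij.
by rewrite mxE eq_sym (negPf ij) mulr0.
Qed.

(** Pulling a form back along [A] is the right action of the compound matrix on its coordinates:
    expand the minors of [rows_mx vs *m A^T] by Cauchy-Binet. *)
Lemma minor_form_mulmx c (A : 'M[int]_n) vs :
  minor_form c (map (mulmx A) vs) = minor_form (c *m compound l A) vs.
Proof.
rewrite /minor_form size_map; case: eqP => // sl.
have -> : rows_mx (map (mulmx A) vs) = rows_mx vs *m A^T.
  apply/matrixP => b k; rewrite !mxE (nth_map 0) ?sl // !mxE.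
  by apply: eq_bigr => q _; rewrite !mxE mulrC.
transitivity (\sum_i \sum_j c 0 i * compound l A i j
    * \det (colsub (tnth (val (enum_val j))) (rows_mx vs))).
  apply: eq_bigr => i _.
  rewrite -mulmx_colsub cauchy_binet mulr_sumr.
  rewrite (reindex (enum_val (A := {: decreasing l n}))) /=; last first.
    exact/onW_bij/enum_val_bij.
  apply: eq_bigr => j _; rewrite mxE -mulrA; congr (_ * _); rewrite mulrC.
  congr (_ * _); rewrite -[RHS]det_tr; congr (\det _).
  by apply/matrixP => a b; rewrite !mxE.
by rewrite exchange_big; apply: eq_bigr => j _ /=; rewrite !mxE mulr_suml.
Qed.

Lemma minor_form_lin a c b d vs :
  minor_form (a *: c + b *: d) vs = a * minor_form c vs + b * minor_form d vs.
Proof.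
rewrite /minor_form; case: eqP => _; last by rewrite !mulr0 addr0.
rewrite !mulr_sumr -big_split; apply: eq_bigr => i _ /=.
by rewrite !mxE; ring.
Qed.

End MinorForm.

(** * The bar complex of the semidirect product *)

Lemma diffE (X : Type) (F : seq X -> int) s :
  diff F s = \sum_(i < size s) (-1) ^+ i * F (take i s ++ drop i.+1 s).
Proof.
elim: s F => [|x s IHs] F /=; first by rewrite big_ord0.
rewrite big_ord_recl /= drop0 mul1r IHs -sumrN; congr (_ + _).
by apply: eq_bigr => i _; rewrite -mulNr exprS mulN1r.
Qed.

Section Conversion.
Variable Gamma : groupType.

(** Extension by zero lets the single operator [diff] serve all degrees; on lists of length [l.+1]
    the default [1%g] is never read. *)
Definition of_cochain l (f : cochain Gamma l) (s : seq Gamma) : int :=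
  if size s == l.+1 then f (fun j => nth 1%g s j) else 0.

Definition to_cochain l (F : seq Gamma -> int) : cochain Gamma l :=
  fun x => F [seq x j | j <- enum 'I_l.+1].

Lemma of_cochainK l : cancel (@of_cochain l) (@to_cochain l).
Proof.
move=> f; apply/funext => x; rewrite /to_cochain /of_cochain.
rewrite size_map size_enum_ord eqxx; congr f; apply/funext => j.
by rewrite (nth_map j) ?size_enum_ord // nth_ord_enum.
Qed.

Lemma to_cochainK l F : (forall s, size s != l.+1 -> F s = 0) ->
  of_cochain (@to_cochain l F) = F.
Proof.
move=> F0; apply/funext => s; rewrite /to_cochain /of_cochain.
case: eqP => [sl|/eqP/F0->//]; congr F.
apply: (@eq_from_nth _ 1%g); rewrite size_map size_enum_ord // => i il.
by rewrite (nth_map (Ordinal il)) ?size_enum_ord // nth_enum_ord.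
Qed.

Lemma coboundary_to_cochain l F :
  coboundary (@to_cochain l F) = @to_cochain l.+1 (diff F).
Proof.
apply/funext => x; rewrite /coboundary /to_cochain diffE size_map size_enum_ord.
apply: eq_bigr => i _; congr (_ * F _).
have sx : size [seq x j | j <- enum 'I_l.+2] = l.+2.
  by rewrite size_map size_enum_ord.
have se : size (take i [seq x j | j <- enum 'I_l.+2]
    ++ drop i.+1 [seq x j | j <- enum 'I_l.+2]) = l.+1.
  by rewrite size_cat size_take size_drop sx ltn_ord; have := ltn_ord i; lia.
apply: (@eq_from_nth _ 1%g); first by rewrite se size_map size_enum_ord.
move=> j; rewrite size_map size_enum_ord => jl.
rewrite (nth_map (Ordinal jl)) ?size_enum_ord //=.
have -> : nth (Ordinal jl) (enum 'I_l.+1) j = Ordinal jl.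
  by apply: val_inj; rewrite /= nth_enum_ord.
rewrite nth_cat size_take sx ltn_ord.
have xE k (kl : (k < l.+2)%N) :
    nth 1%g [seq x j | j <- enum 'I_l.+2] k = x (Ordinal kl).
  rewrite (nth_map (Ordinal kl)) ?size_enum_ord //; congr x.
  by apply: val_inj; rewrite /= nth_enum_ord.
have jl2 : (bump i j < l.+2)%N by rewrite /bump; case: leqP; lia.
have -> : lift i (Ordinal jl) = Ordinal jl2 by apply: val_inj.
rewrite -xE /bump; case: leqP => ij; last by rewrite nth_take.
by rewrite nth_drop; congr nth; lia.
Qed.

Lemma diff_of_cochain l (f : cochain Gamma l) :
  diff (of_cochain f) = of_cochain (coboundary f).
Proof.
rewrite -{2}[f]of_cochainK coboundary_to_cochain to_cochainK // => s sl.
rewrite diffE big1 // => i _.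
rewrite /of_cochain size_cat size_take size_drop ltn_ord.
case: eqP => [E|]; last by rewrite mulr0.
by move: sl E; case: i => i /= il; lia.
Qed.

Definition left_invariant (F : seq Gamma -> int) :=
  forall (a : Gamma) s, F (map (fun x => a * x)%g s) = F s.

Lemma of_cochain_invariant l (f : cochain Gamma l) :
  invariant_cochain f -> left_invariant (of_cochain f).
Proof.
move=> fi a s; rewrite /of_cochain size_map; case: eqP => // sl.
rewrite -[RHS](fi a); congr f; apply/funext => j.
by rewrite (nth_map 1%g) ?sl.
Qed.

Lemma to_cochain_invariant l F :
  left_invariant F -> invariant_cochain (@to_cochain l F).
Proof.
move=> iF a x; rewrite /to_cochain -[RHS](iF a) -[in RHS]map_comp;
  congr F; apply: eq_map.
Qed.

(* The cochain complex of [seq]-functions has to be truncated below degree 0: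
   [h [::] = 0] excludes the augmentation. *)
Lemma is_coboundaryP l (f : cochain Gamma l) :
  is_coboundary f <-> exists h, [/\ h [::] = 0, left_invariant h
    & forall s, diff h s = of_cochain f s].
Proof.
split.
  case: l f => [|l] f /=.
    move=> ->; exists (fun=> 0); split=> // s; rewrite /of_cochain.
    have -> : diff (fun=> 0) s = 0 by elim: s => //= x s ->; rewrite subrr.
    by case: ifP.
  case=> h hi ->; exists (of_cochain h); split=> //.
    exact: of_cochain_invariant.
  by move=> s; rewrite diff_of_cochain.
case=> h [h0 hi dh].
have fE : f = @to_cochain l (diff h).
  by rewrite -[LHS]of_cochainK; congr to_cochain; apply/funext.
case: l f dh fE => [|l] f dh fE /=.
  rewrite fE; apply/funext => x; rewrite /to_cochain.
  have : size [seq x j | j <- enum 'I_1] = 1%N by rewrite size_map size_enum_ord.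
  by case: map => [|y []] //= _; rewrite h0 subrr.
exists (@to_cochain l h); first exact: to_cochain_invariant.
by rewrite coboundary_to_cochain.
Qed.

End Conversion.

(** * Translations and rotations in the semidirect product *)

Section SemidirectCohomology.
Variables (gT : finGroupType) (n : nat).
Variable rho : mx_representation int [set: gT] n.
Local Notation Gamma := (semidirect rho).

Definition translation (v : 'cV[int]_n) (x : Gamma) : Gamma :=
  (((v, 1%g) : Gamma) * x)%g.
Definition rotation (a : gT) (x : Gamma) : Gamma := (((0, a) : Gamma) * x)%g.
Definition vec (x : Gamma) : 'cV[int]_n := x.1.

Lemma vec_translation v x : vec (translation v x) = v + vec x.
Proof. by rewrite /vec /= repr_mx1 mul1mx. Qed.

Lemma translation0 x : translation 0 x = x.
Proof. exact: mul1g. Qed.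

Lemma translationD u v x :
  translation (u + v) x = translation u (translation v x).
Proof.
rewrite /translation mulgA; congr (_ * _)%g.
by congr pair => /=; rewrite ?repr_mx1 ?mul1mx ?mulg1.
Qed.

Lemma vec_rotation a x y :
  vec (rotation a x) - vec (rotation a y) = rho a *m (vec x - vec y).
Proof. by rewrite /vec /= !add0r mulmxBr. Qed.

(** Rotations normalize translations; hence a rotate of a translation-invariant cochain is still
    translation-invariant. *)
Lemma rotation_translation a v x :
  rotation a (translation v x) = translation (rho a *m v) (rotation a x).
Proof.
rewrite /rotation /translation !mulgA; congr (_ * _)%g.
by congr pair => /=; rewrite ?repr_mx1 ?mulmx0 ?addr0 ?add0r ?mulg1 ?mul1g.
Qed.

Lemma semidirect_mulE v a x :
  (((v, a) : Gamma) * x)%g = translation v (rotation a x).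
Proof.
rewrite /translation /rotation mulgA; congr (_ * _)%g.
by congr pair => /=; rewrite ?repr_mx1 ?mulmx0 ?addr0 ?mul1g.
Qed.

Lemma left_invariantP F : left_invariant F <->
  (forall v, invariant_under translation v F) /\
  (forall a s, F (map (rotation a) s) = F s).
Proof.
split=> [iF|[tF rF] [v a] s]; first by split=> [v s|a s]; apply: iF.
rewrite (eq_map (semidirect_mulE v a)) map_comp.
by rewrite -[RHS](rF a) -[RHS](tF v).
Qed.

End SemidirectCohomology.

(** * Periods of cocycles *)

Section InvariantForms.
Variables (gT : finGroupType) (n : nat).
Variable rho : mx_representation int [set: gT] n.
Variables (g : gT) (l : nat).
Hypothesis gen : generator [set: gT] g.
Local Notation Gamma := (semidirect rho).
Local Notation N := #|{: decreasing l n}|.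
Local Notation M := (compound l (rho g)).
Local Notation translation := (@translation gT n rho).
Local Notation rotation := (@rotation gT n rho).
Implicit Types (c : 'rV[int]_N) (f : cochain Gamma l).

Definition form_seq c : seq Gamma -> int :=
  form_cochain (@vec gT n rho) (minor_form c).

Definition form_class c : cochain Gamma l := @to_cochain Gamma l (form_seq c).

Lemma form_seq_lin a c b d s :
  form_seq (a *: c + b *: d) s = a * form_seq c s + b * form_seq d s.
Proof.
case: s => [|x s] /=; first by rewrite !mulr0 addr0.
exact: minor_form_lin.
Qed.

Lemma form_seq_size c s : size s != l.+1 -> form_seq c s = 0.
Proof.
case: s => //= x s; rewrite eqSS /minor_form size_pairmap.
by move=> /negPf ->.
Qed.

Lemma of_form_class c : of_cochain (form_class c) = form_seq c.
Proof. exact/to_cochainK/form_seq_size. Qed.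

Lemma form_seq_rot a c s :
  form_seq c (map (rotation a) s) = form_seq (c *m compound l (rho a)) s.
Proof.
rewrite /form_seq (form_cochain_equiv (p := rotation a) (A := rho a)); last first.
  by move=> x y; apply: vec_rotation.
case: s => //= x s; exact: minor_form_mulmx.
Qed.

Lemma form_seq_trn c v : invariant_under translation v (form_seq c).
Proof. by apply: form_cochain_inv => u x; apply: vec_translation. Qed.

(** Translations preserve steps, and a row fixed by the compound matrix of the generator is fixed by
    those of all its powers. *)
Lemma form_seq_invariant c : c *m M = c -> left_invariant (form_seq c).
Proof.
move=> cM; apply/left_invariantP; split; first exact: form_seq_trn.
move=> a s; rewrite form_seq_rot; congr form_seq.
have /cycleP[k ->] : a \in <[g]>%g by rewrite -(eqP gen) inE.
elim: k => [|k IHk]; first by rewrite expg0 repr_mx1 compound1 mulmx1.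
by rewrite expgS repr_mxM ?inE // compoundM mulmxA cM.
Qed.

Lemma diff_form_seq c s : diff (form_seq c) s = 0.
Proof. exact/diff_form_cochain/minor_form_multiadditive. Qed.

Lemma contracts_form_seq c (i : 'I_N) :
  contracts translation (val (enum_val i)) (form_seq c) [:: 1%g]
    = l`!%:Z * c 0 i.
Proof.
rewrite /form_seq contracts_form_base; last exact: minor_form_skew.
  by rewrite size_tuple minor_form_basis.
exact: vec_translation.
Qed.

(** The periods of a coboundary vanish, whereas those of [form_seq c] are [l!] times [c]. *)
Lemma form_seq_coboundary c h : h [::] = 0 ->
  (forall v, invariant_under translation v h) ->
  (forall s, diff h s = form_seq c s) -> c = 0.
Proof.
move=> h0 hi dh; apply/rowP => i; rewrite mxE.
have := contracts_form_seq c i; have -> : form_seq c = diff h by apply/funext.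
rewrite contracts_diff //; last exact: translationD.
by move/esym/eqP; rewrite mulf_eq0 eqz_nat (gtn_eqF (fact_gt0 l)) => /eqP.
Qed.

Definition periods f : 'rV[int]_N :=
  \row_(i < N) contracts translation
    (val (enum_val (A := {: decreasing l n}) i)) (of_cochain f) [:: 1%g].

(** At a singleton, [size js] contractions evaluate only lists of length [(size js).+1]. *)
Lemma contracts_of_cochain f js : size js != l ->
  contracts translation js (of_cochain f) [:: 1%g] = 0.
Proof.
move=> sjs.
have -> : of_cochain f = (fun s => (size s == l.+1)%:Z * of_cochain f s).
  by apply/funext => s; rewrite /of_cochain; case: eqP; rewrite ?mul1r ?mul0r.
rewrite (contracts_size translation (fun k => (k == l.+1)%:Z)) /= add1n eqSS.
by rewrite (negPf sjs) mul0r.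
Qed.

(** The form cocycle of [periods f] has periods [l!] times [periods f], as does [l!] times [f]. The
    difference has zero periods, so [cocycle_exact] applies with all [n] generators. *)
Lemma cocycle_form f : invariant_cochain f -> coboundary f = 0 ->
  exists h, [/\ h [::] = 0, forall v, invariant_under translation v h
    & forall s, diff h s = l`!%:Z * of_cochain f s - form_seq (periods f) s].
Proof.
move=> /of_cochain_invariant/left_invariantP[tf _] df.
pose F s := l`!%:Z * of_cochain f s + (-1) * form_seq (periods f) s.
have [||i _ s|js js1 js2|h [h0 hi dh]] :=
  @cocycle_exact n _ translation (@vec gT n rho) (@translation0 _ _ _)
    (@translationD _ _ _) (@vec_translation _ _ _) 1%g n F (leqnn n).
- by rewrite /F /of_cochain /= !mulr0 addr0.
- move=> s; rewrite /F diff_lin diff_form_seq mulr0 addr0 diff_of_cochain df.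
  by rewrite /of_cochain; case: ifP; rewrite mulr0.
- rewrite /trans /F; congr (_ * _ + _ * _); [exact: tf | exact: form_seq_trn].
- rewrite contracts_lin; have [/eqP sjs|sjs] := eqVneq (size js) l; last first.
    rewrite -of_form_class !contracts_of_cochain // !mulr0 addr0 //.
  pose t : decreasing l n := exist _ (Tuple sjs) js1.
  have -> : js = val (enum_val (enum_rank t)) by rewrite enum_rankK.
  by rewrite contracts_form_seq mxE mulN1r subrr.
exists h; split=> //; last by move=> s; rewrite dh /F mulN1r.
apply: invariant_gen; [exact: translation0|exact: translationD|move=> i; exact: hi].
Qed.

(** Rotating the primitive [h] of [cocycle_form] by [g] and subtracting [h] eliminates [f], which is
    invariant. The form cocycle of [periods f - periods f *m M] thus bounds, so its coordinates
    vanish. *)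
Lemma periods_fixed f : invariant_cochain f -> coboundary f = 0 ->
  periods f *m M = periods f.
Proof.
move=> fi df; have [h [h0 hi dh]] := cocycle_form fi df.
have /left_invariantP[_ rf] := of_cochain_invariant fi.
apply/esym/eqP; rewrite -subr_eq0; apply/eqP.
pose h' s := 1 * h (map (rotation g) s) + (-1) * h s.
apply: (@form_seq_coboundary _ h').
- by rewrite /h' /= h0 !mulr0 addr0.
- move=> v s; rewrite /trans /h' -(hi v s) /trans -[in RHS](hi (rho g *m v)).
  congr (1 * _ + _); rewrite /trans -!map_comp; congr h; apply: eq_map => x /=.
  exact: rotation_translation.
- move=> s; rewrite /h' diff_lin diff_map !dh rf form_seq_rot.
  rewrite -[periods f - _]/(_ + _) -[X in form_seq (X + _)]scale1r -scaleN1r.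
  by rewrite form_seq_lin; ring.
Qed.

(** With zero periods, [l!] times [f] has a translation-invariant primitive. Summing its rotates
    over the group makes it fully invariant and multiplies the coboundary by [#|gT|]. *)
Lemma cocycle_torsion f : invariant_cochain f -> coboundary f = 0 ->
  periods f = 0 -> exists h, [/\ h [::] = 0, left_invariant h
    & forall s, diff h s = (#|gT| * l`!)%:Z * of_cochain f s].
Proof.
move=> fi df pf; have [h [h0 hi dh]] := cocycle_form fi df.
have /left_invariantP[_ rf] := of_cochain_invariant fi.
exists (fun s => \sum_(a : gT) h (map (rotation a) s)); split.
- by rewrite big1.
- apply/left_invariantP; split=> [v s|b s].
    apply: eq_bigr => a _; rewrite -[RHS](hi (rho a *m v)) /trans -!map_comp.
    by congr h; apply: eq_map => x /=; rewrite rotation_translation.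
  rewrite [RHS](reindex_inj (mulIg b)) /=; apply: eq_bigr => a _.
  rewrite -map_comp; congr h; apply: eq_map => x /=; rewrite /rotation mulgA.
  by congr (_ * _)%g; congr pair => /=; rewrite mulmx0 addr0.
- move=> s.
  have -> : diff (fun s => \sum_(a : gT) h (map (rotation a) s)) s
      = \sum_(a : gT) diff h (map (rotation a) s).
    rewrite diffE; under [RHS]eq_bigr => a _ do rewrite -diff_map diffE.
    by rewrite exchange_big; apply: eq_bigr => i _; rewrite mulr_sumr.
  have p0 t : form_seq 0 t = 0.
    case: t => //= x t; rewrite /minor_form; case: ifP => // _.
    by rewrite big1 // => i _; rewrite mxE mul0r.
  under eq_bigr => a _ do rewrite dh rf pf p0 subr0.
  by rewrite sumr_const -mulr_natl natz PoszM mulrA.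
Qed.

Lemma periods_is_zmod_morphism : zmod_morphism periods.
Proof.
move=> f h; apply/rowP => i; rewrite !mxE -[RHS]/(_ + - _).
rewrite -[X in _ = _ + X]mulN1r -[X in _ = X + _]mul1r.
rewrite -contracts_lin; congr contracts; apply/funext => s.
rewrite /of_cochain; case: ifP => _; last by rewrite !mulr0 addr0.
by rewrite mul1r mulN1r.
Qed.

Lemma periods_form_class c : periods (form_class c) = l`!%:Z *: c.
Proof. by apply/rowP => i; rewrite !mxE of_form_class contracts_form_seq. Qed.

Lemma form_class_cocycle c : c *m M = c ->
  invariant_cochain (form_class c) /\ coboundary (form_class c) = 0.
Proof.
move=> cM; split; first exact/to_cochain_invariant/form_seq_invariant.
rewrite /form_class coboundary_to_cochain; apply/funext => x.
exact: diff_form_seq.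
Qed.

Lemma periods_coboundary f : is_coboundary f -> periods f = 0.
Proof.
move=> /is_coboundaryP[h [h0 /left_invariantP[hi _] dh]].
apply/rowP => i; rewrite !mxE; have -> : of_cochain f = diff h by apply/funext.
by rewrite contracts_diff //; apply: translationD.
Qed.

End InvariantForms.

(** * Ranks of fixed lattices *)

Section RankDiag.
Variable F : fieldType.

Lemma mxrank_diag_leq N (d : 'rV[F]_N) :
  (\rank (diag_mx d) <= #|[pred i | d 0 i != 0]%R|)%N.
Proof.
have -> : diag_mx d = \sum_(i | d 0 i != 0) d 0 i *: delta_mx i i.
  rewrite [LHS]matrix_sum_delta [RHS]big_mkcond; apply: eq_bigr => i _.
  rewrite (bigD1 i) //= mxE eqxx big1 ?addr0 => [|j ij].
    by case: eqP => [->|//]; rewrite scale0r.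
  by rewrite mxE eq_sym (negPf ij) mulr0n scale0r.
rewrite -sum1_card; elim/big_rec2: _ => [|i A k _ le]; first by rewrite mxrank0.
apply: leq_trans (mxrank_add _ _) _; apply: leq_add => //.
by rewrite (leq_trans (mxrank_scale _ _)) // mxrank_delta.
Qed.

Lemma mxrank_ker_diag N (d : 'rV[F]_N) :
  \rank (kermx (diag_mx d)) = #|[pred i | d 0 i == 0]|.
Proof.
rewrite mxrank_ker; have le1 := mxrank_diag_leq d.
(* With the indicator [d'] of the zero entries added, the diagonal matrix is invertible;
   subadditivity of the rank then makes both upper bounds sharp. *)
pose d' := \row_i (d 0 i == 0)%:R : 'rV[F]_N.
have le2 := mxrank_diag_leq d'.
have E2 : #|[pred i | d' 0 i != 0]| = #|[pred i | d 0 i == 0]|.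
  apply: eq_card => i; rewrite !inE mxE.
  by case: (d 0 i == 0); rewrite ?mulr1n ?oner_eq0 ?eqxx.
have C := cardC [pred i | d 0 i == 0]; rewrite card_ord in C.
have le3 : (N <= \rank (diag_mx d) + \rank (diag_mx d'))%N.
  apply: leq_trans (mxrank_add _ _); rewrite -raddfD /= mxrank_unit //.
  rewrite unitmxE det_diag unitfE; apply/prodf_neq0 => i _.
  rewrite !mxE; have [->|] := eqVneq (d 0 i) 0.
    by rewrite mulr1n add0r oner_eq0.
  by rewrite mulr0n addr0.
have C' : #|[pred i | d 0 i != 0]| = #|[predC [pred i | d 0 i == 0]]|.
  exact: eq_card.
rewrite E2 in le2; rewrite C' in le1.
move: le1 le2 le3 C; move: (\rank _) (\rank _) #|_| #|_| => a b c e; lia.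
Qed.

End RankDiag.

Section RationalKernel.

Lemma clear_denominators (I : finType) (a : I -> rat) :
  exists2 d : int, d != 0 &
    exists z : I -> int, forall i, d%:~R * a i = (z i)%:~R.
Proof.
exists (\prod_i denq (a i)); first by apply/prodf_neq0 => i _; apply: denq_neq0.
exists (fun i => \prod_(j | j != i) denq (a j) * numq (a i)) => i.
rewrite (bigD1 i) //= [denq _ * _]mulrC !rmorphM -mulrA; congr (_ * _).
by rewrite mulrC -{1}(divq_num_den (a i)) divfK // intr_eq0 denq_neq0.
Qed.

Lemma map_mx_intr_inj m n :
  injective (map_mx intr : 'M[int]_(m, n) -> 'M[rat]_(m, n)).
Proof.
move=> A B /matrixP E; apply/matrixP => i j.
by have := E i j; rewrite !mxE => /intr_inj.
Qed.

Variables (N : nat) (M : 'M[int]_N).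
Local Notation K := (kermx (map_mx intr M - 1%:M : 'M[rat]_N)).

(** A rational basis of the fixed space is cleared of denominators; it need not generate the fixed
    lattice, as only independence matters for the rank. *)
Lemma int_fixed_basis : exists W : 'M[int]_(\rank K, N),
  W *m M = W /\ forall c : 'rV[int]_(\rank K), c *m W = 0 -> c = 0.
Proof.
have [d d0 [z zE]] := clear_denominators (fun q => row_base K q.1 q.2).
pose W : 'M[int]_(\rank K, N) := \matrix_(i, j) z (i, j).
have WE : map_mx intr W = d%:~R *: row_base K.
  by apply/matrixP => i j; rewrite mxE mxE -zE [RHS]mxE.
have dr : d%:~R != 0 :> rat by rewrite intr_eq0.
exists W; split.
  apply: map_mx_intr_inj; rewrite map_mxM WE.
  have : row_base K *m (map_mx intr M - 1%:M) = 0.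
    by apply/sub_kermxP; rewrite eq_row_base.
  by rewrite mulmxBr mulmx1 -scalemxAl => /subr0_eq ->.
move=> c cW; apply: map_mx_intr_inj; rewrite map_mx0.
apply: (row_free_inj (row_base_free K)); rewrite mul0mx.
have := congr1 (map_mx intr : _ -> 'M[rat]_(_, _)) cW.
rewrite map_mxM WE map_mx0 -scalemxAr.
by move/eqP; rewrite scaler_eq0 (negPf dr) => /eqP.
Qed.

(** The rows exceed the dimension of the rational fixed space, so they satisfy a rational relation,
    made integral by clearing denominators. *)
Lemma int_fixed_dependent (W : 'M[int]_((\rank K).+1, N)) : W *m M = W ->
  exists2 c : 'rV[int]_((\rank K).+1), c != 0 & c *m W = 0.
Proof.
move=> WM; pose WQ : 'M[rat]_(_, _) := map_mx intr W.
have WK : (WQ <= K)%MS.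
  by apply/sub_kermxP; rewrite mulmxBr mulmx1 -map_mxM WM subrr.
have : kermx WQ != 0.
  rewrite -mxrank_eq0 mxrank_ker -lt0n subn_gt0 ltnS; exact: mxrankS.
case/rowV0Pn => u /sub_kermxP uW u0.
have [d d0 [z zE]] := clear_denominators (fun i => u 0 i).
have dr : d%:~R != 0 :> rat by rewrite intr_eq0.
pose c : 'rV[int]_((\rank K).+1) := \row_i z i.
have cE : map_mx intr c = d%:~R *: u.
  by apply/rowP => i; rewrite !mxE zE.
exists c.
  apply: contraNneq u0 => c0; move: cE; rewrite c0 map_mx0 => /esym/eqP.
  by rewrite scaler_eq0 (negPf dr).
by apply: map_mx_intr_inj; rewrite map_mxM cE -scalemxAl uW scaler0 map_mx0.
Qed.

End RationalKernel.

Lemma compound_map (R S : comNzRingType) (f : {rmorphism R -> S}) l n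
    (A : 'M[R]_n) :
  compound l (map_mx f A) = map_mx f (compound l A).
Proof. by apply/matrixP => i j; rewrite !mxE -map_mxsub det_map_mx. Qed.

(** * Diagonalization and fixed vectors of compound matrices *)

Section FiniteOrder.
Variable F : numClosedFieldType.

(** The minimal polynomial divides ['X^#[g] - 1], which is separable in characteristic 0. *)
Lemma finite_order_diagonalizable (gT : finGroupType) n
    (rG : mx_representation F [set: gT] n) (g : gT) : diagonalizable (rG g).
Proof.
case: n rG => [|n] rG.
  by rewrite (_ : rG g = 0) ?[rG g]flatmx0 //; apply: diagonalizable0.
have [rs rsE] := closed_field_poly_normal ('X^#[g]%g - 1 : {poly F}).
have lc : lead_coef ('X^#[g]%g - 1 : {poly F}) = 1.
  by apply/monicP/monicXnsubC/order_gt0.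
rewrite lc scale1r in rsE.
apply/diagonalizableP; exists rs.
  rewrite -separable_prod_XsubC -rsE separable_Xn_sub_1 //.
  by rewrite pnatr_eq0 -lt0n order_gt0.
rewrite -rsE; apply: mxminpoly_min.
rewrite rmorphB rmorph1 rmorphXn /= horner_mx_X -repr_mxX ?inE //.
by rewrite expg_order repr_mx1 subrr.
Qed.

Lemma char_poly_similar n (P A B : 'M[F]_n) : P \in unitmx ->
  P *m A = B *m P -> char_poly A = char_poly B.
Proof.
move=> Pu PA; rewrite /char_poly.
have PuX : \det (map_mx polyC P) != 0.
  by rewrite det_map_mx polyC_eq0 -unitfE -unitmxE.
apply: (mulfI PuX); rewrite -det_mulmx [RHS]mulrC -det_mulmx; congr (\det _).
rewrite /char_poly_mx mulmxBr mulmxBl -!map_mxM PA.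
by rewrite scalar_mxC.
Qed.

(** Compounds are multiplicative, so [compound l P] is invertible and diagonalizes
    [compound l A - 1%:M]; its diagonal entries are the [l]-fold products of eigenvalues minus 1. *)
Lemma rank_ker_compound l n (P A : 'M[F]_n) (d : 'rV[F]_n) : P \in unitmx ->
  P *m A = diag_mx d *m P ->
  \rank (kermx (compound l A - 1%:M))
    = #|[pred t : decreasing l n | \prod_a d 0 (tnth (val t) a) == 1]|.
Proof.
move=> Pu PA; pose d' : 'rV[F]_#|{: decreasing l n}| :=
  \row_i (\prod_a
    d 0 (tnth (val (enum_val (A := {: decreasing l n}) i)) a) - 1).
have Cu : compound l P \in unitmx.
  have /mulmx1_unit[] // : compound l P *m compound l (invmx P) = 1%:M.
  by rewrite -compoundM mulmxV // compound1.
have CA : compound l P *m (compound l A - 1%:M) = diag_mx d' *m compound l P.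
  rewrite mulmxBr -compoundM PA compoundM compound_diag mulmx1.
  rewrite -[X in _ - X]mul1mx -mulmxBl -diag_const_mx -raddfB /=.
  by congr (diag_mx _ *m _); apply/rowP => i; rewrite !mxE.
have -> : \rank (kermx (compound l A - 1%:M)) = \rank (kermx (diag_mx d')).
  rewrite !mxrank_ker; congr (_ - _)%N.
  rewrite -(mxrankMfree (diag_mx d') (B := compound l P)) ?row_free_unit // -CA.
  by rewrite eqmxMfull // row_full_unit.
rewrite mxrank_ker_diag -[RHS]sum1_card.
rewrite [RHS](reindex (enum_val (A := {: decreasing l n}))) /=; last first.
  exact/onW_bij/enum_val_bij.
by rewrite -sum1_card; apply: eq_bigl => i; rewrite !inE mxE subr_eq0.
Qed.

End FiniteOrder.

(** * The rank of the cohomology *)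

Lemma count_wedge (R : realType) l n (d : 'rV[R[i]]_n) (s : seq R[i]) :
  perm_eq s [seq d 0 i | i <- enum 'I_n] ->
  count 1.-unity_root (wedge l s)
    = #|[pred t : decreasing l n | \prod_a d 0 (tnth (val t) a) == 1]|.
Proof.
move=> sd; have ss : size s = n.
  by rewrite (perm_size sd) size_map size_enum_ord.
case: n / ss d sd => d sd.
have /tuple_permP[p sE] : perm_eq s [tuple d 0 i | i < size s] by [].
(* [p] matches the positions of [s] with the indices of [d]; [h t] is the set of positions in [s] of
   the eigenvalues selected by [t]. *)
pose h (t : decreasing l (size s)) :=
  [set (p^-1)%g (tnth (val t) a) | a : 'I_l].
have card_h t : #|h t| = l.
  rewrite card_imset ?card_ord //.
  exact: inj_comp (@perm_inj _ _) (@decreasing_inj _ _ t).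
have h_inj : injective h.
  move=> t u /setP E; apply: decreasing_eq_mem => a.
  have := E ((p^-1)%g (tnth (val t) a)).
  rewrite imset_f // => /esym/imsetP[b _ /perm_inj ->].
  exact: mem_tnth.
have hE : [set J : {set 'I_(size s)} | #|J| == l] = h @: setT.
  apply/setP => J; rewrite inE; apply/eqP/imsetP => [cJ|[t _ ->]];
    last exact: card_h.
  pose f (a : 'I_l) := p (enum_val (cast_ord (esym cJ) a)).
  have fi : injective f by move=> a b /perm_inj/enum_val_inj/cast_ord_inj.
  have [t [r fE]] := decreasing_perm fi.
  exists t => //; apply/eqP; rewrite eqEcard card_h cJ leqnn andbT.
  apply/subsetP => j jJ; apply/imsetP.
  exists (r (cast_ord cJ (enum_rank_in jJ j))) => //.
  by rewrite -fE /f cast_ord_comp cast_ord_id enum_rankK_in // permK.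
rewrite /wedge -sum1_count big_map big_enum_cond /= hE big_imset_cond; last first.
  by move=> t u _ _; apply: h_inj.
rewrite -sum1_card; apply: eq_bigl => t; rewrite !inE /=.
rewrite unity_rootE expr1 big_imset /=; last first.
  by move=> a b _ _ /perm_inj/decreasing_inj.
congr (_ == _); apply: eq_bigr => a _.
have := congr1 (fun q => nth 0 q ((p^-1)%g (tnth (val t) a))) sE.
by rewrite nth_mktuple permKV tnth_mktuple.
Qed.

Lemma scalemx_idomain_eq0 (R : idomainType) m n (k : R) (A : 'M[R]_(m, n)) :
  k != 0 -> k *: A = 0 -> A = 0.
Proof.
move=> k0 /matrixP E; apply/matrixP => i j; have := E i j; rewrite !mxE.
by move/eqP; rewrite mulf_eq0 (negPf k0) => /eqP.
Qed.

(** [per] factors through [A], with kernel killed by [K] and image between the lattice fixed by [M]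
    and its multiple by [k]; hence [A] and that lattice have equal rank. *)
Lemma has_rank_fixed (A Z : zmodType) (pi : {additive Z -> A}) N
    (per : {additive Z -> 'rV[int]_N}) (M : 'M[int]_N) (k K : int) :
  (forall a, exists z, pi z = a) ->
  k != 0 -> K != 0 ->
  (forall z, per z *m M = per z) ->
  (forall z, per z = 0 -> pi z *~ K = 0) ->
  (forall z, pi z = 0 -> per z = 0) ->
  (forall c, c *m M = c -> exists z, per z = k *: c) ->
  has_rank A (\rank (kermx (map_mx intr M - 1%:M : 'M[rat]_N))).
Proof.
move=> surj k0 K0 perM torsion per0 lift; split.
  have [W [WM Wfree]] := int_fixed_basis M.
  have wM i : row i W *m M = row i W by rewrite -row_mul WM.
  have [z zE] := choice (fun i => lift _ (wM i)).
  exists (fun i => pi (z i)) => c cz i.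
  have : \sum_i per (z i) *~ c i = 0.
    under eq_bigr => j _ do rewrite -raddfMz.
    rewrite -raddf_sum; apply: per0; rewrite raddf_sum -[RHS]cz.
    by apply: eq_bigr => j _; rewrite raddfMz.
  under eq_bigr => j _ do rewrite zE -scaler_int intz scalerA mulrC -scalerA.
  rewrite -scaler_sumr => /(scalemx_idomain_eq0 k0) E.
  have /Wfree/rowP/(_ i) : (\row_j c j) *m W = 0.
    by rewrite mulmx_sum_row -[RHS]E; apply: eq_bigr => j _; rewrite mxE.
  by rewrite !mxE.
move=> v vfree; have [z zE] := choice (fun i => surj (v i)).
pose W := \matrix_i per (z i).
have WM : W *m M = W by apply/row_matrixP => i; rewrite row_mul rowK perM.
have [c c0 cW] := int_fixed_dependent WM.
have E : per (\sum_i z i *~ c 0 i) = 0.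
  rewrite raddf_sum -[RHS]cW mulmx_sum_row; apply: eq_bigr => i _.
  by rewrite raddfMz rowK -scaler_int intz.
case/eqP: c0; apply/rowP => i; rewrite mxE.
(* A relation among the periods yields a relation in [A] only after multiplication by [K]. *)
have : c 0 i * K = 0.
  apply: (vfree (fun i => c 0 i * K)); rewrite -[RHS](torsion _ E) raddf_sum.
  rewrite mulrz_suml; apply: eq_bigr => j _.
  by rewrite raddfMz zE mulrzA.
by move/eqP; rewrite mulf_eq0 (negPf K0) orbF => /eqP.
Qed.

Section CohomologyClass.
Variables (Gamma : groupType) (l : nat).
Local Notation quotient := (Quotient.quot (GRing.ZmodClosed.clone (cocycle Gamma l)
  (@coboundary_pred Gamma l) _)).

Definition cohomology_class (f : cocycle Gamma l) : cohomology Gamma l :=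
  \pi_quotient%qT f.

Lemma cohomology_class_is_zmod_morphism : zmod_morphism cohomology_class.
Proof. exact: pi_is_zmod_morphism. Qed.

HB.instance Definition _ := GRing.isZmodMorphism.Build _ _ cohomology_class
  cohomology_class_is_zmod_morphism.

Lemma cohomology_class_surj (a : cohomology Gamma l) :
  exists f, cohomology_class f = a.
Proof.
exists (generic_quotient.repr (a : quotient)); exact: generic_quotient.reprK.
Qed.

Lemma cohomology_class_eq0 f : cohomology_class f = 0 <-> is_coboundary (val f).
Proof.
rewrite -(raddf0 cohomology_class); split=> [/eqP|E]; last apply/eqP.
  by rewrite -Quotient.idealrBE subr0 => /asboolP.
by rewrite -Quotient.idealrBE subr0; apply/asboolP.
Qed.

End CohomologyClass.

Section MainTheorem.
Variables (gT : finGroupType) (n : nat).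
Variable rho : mx_representation int [set: gT] n.
Variables (g : gT) (l : nat).
Hypothesis gen : generator [set: gT] g.
Local Notation Gamma := (semidirect rho).
Local Notation M := (compound l (rho g)).

Definition cocycle_periods (f : cocycle Gamma l) := periods (val f).

Lemma cocycle_periods_is_zmod_morphism : zmod_morphism cocycle_periods.
Proof.
by move=> f h; rewrite /cocycle_periods raddfB; apply: periods_is_zmod_morphism.
Qed.

HB.instance Definition _ := GRing.isZmodMorphism.Build _ _ cocycle_periods
  cocycle_periods_is_zmod_morphism.

Lemma has_rank_cohomology : has_rank (cohomology Gamma l)
  (\rank (kermx (map_mx intr M - 1%:M : 'M[rat]_(_)))).
Proof.
have valc (f : cocycle Gamma l) :
    invariant_cochain (val f) /\ coboundary (val f) = 0.
  by case: f => f fP; apply/asboolP.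
(* The factor [l!] is that of [periods_form_class], and [#|gT| * l!] is that of
   [cocycle_torsion]. *)
apply: (@has_rank_fixed _ _ (@cohomology_class Gamma l) _ cocycle_periods M
  l`!%:Z (#|gT| * l`!)%:Z).
- exact: cohomology_class_surj.
- by rewrite eqz_nat (gtn_eqF (fact_gt0 l)).
- rewrite eqz_nat muln_eq0 (gtn_eqF (fact_gt0 l)) orbF -lt0n.
  by apply/card_gt0P; exists g.
- by move=> f; have [fi df] := valc f; apply: periods_fixed.
- move=> f pf; have [fi df] := valc f.
  have [h [h0 hi dh]] := cocycle_torsion fi df pf.
  rewrite -raddfMz; apply/cohomology_class_eq0/is_coboundaryP.
  exists h; split=> //.
  move=> s; rewrite dh /of_cochain; case: ifP => _; last by rewrite mulr0.
  rewrite raddfMz -[in RHS]pmulrn natmulfctE.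
  by rewrite -mulr_natl natz.
- by move=> f /cohomology_class_eq0/periods_coboundary.
- move=> c cM; have /asboolP fP := form_class_cocycle gen cM.
  exists (Cocycle fP); exact: periods_form_class.
Qed.

Lemma has_rank_cohomology_count (R : realType) : has_rank (cohomology Gamma l)
  (count 1.-unity_root
    (wedge l (eigenvalues (map_mx intr (rho g) : 'M[R[i]]_n)))).
Proof.
set A : 'M[R[i]]_n := map_mx intr (rho g).
have [P Pu /diagonalizable_forPex[d /(simmxP Pu) PA]] : diagonalizable A.
  rewrite /A -[map_mx _ _]/(map_repr intr rho g).
  exact: finite_order_diagonalizable.
have cA : perm_eq (eigenvalues A) [seq d 0 i | i <- enum 'I_n].
  apply: prod_XsubC_eq; rewrite big_map big_enum /=.
  transitivity (char_poly A).
    rewrite /eigenvalues; case: closed_field_poly_normal => s /= sE.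
    by rewrite [RHS]sE (monicP (char_poly_monic A)) scale1r.
  rewrite (char_poly_similar Pu PA) char_poly_trig; last first.
    by apply: diag_mx_is_trig.
  by apply: eq_bigr => i _; rewrite mxE eqxx.
rewrite (count_wedge l cA) -(rank_ker_compound l Pu PA).
suff -> : \rank (kermx (compound l A - 1%:M))
    = \rank (kermx (map_mx intr M - 1%:M : 'M[rat]_(_))) by exact: has_rank_cohomology.
(* The rank of an integer matrix is the same over [rat] and over [R[i]]. *)
rewrite !mxrank_ker; congr (_ - _)%N.
rewrite -[RHS](mxrank_map (ratr : rat -> R[i])) map_mxB map_mx1.
rewrite compound_map -map_mx_comp; congr (\rank (_ - _)).
by apply/matrixP => i j; rewrite !mxE /= ratr_int.
Qed.

(** Since [m %/ m = 1], the roots of unity counted are those equal to 1; for [l > n] there are no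
    [l]-subsets, so the count is 0 as well. *)
Lemma HcountE (R : realType) (m : nat) : (0 < m)%N -> Hcount R m l m (rho g)
  = count 1.-unity_root
      (wedge l (eigenvalues (map_mx intr (rho g) : 'M[R[i]]_n))).
Proof.
move=> m0; rewrite /Hcount divnn m0; case: leqP => // nl.
rewrite /wedge (_ : enum _ = [::]) //; apply/eqP; rewrite -size_eq0 -cardE.
apply/eqP/eq_card0 => J; rewrite !inE; apply: contraTF nl => /eqP <-.
have sE := size_eigenvalues (map_mx intr (rho g) : 'M[R[i]]_n).
by rewrite -leqNgt -[X in (_ <= X)%N]sE -[X in (_ <= X)%N]card_ord max_card.
Qed.

End MainTheorem.

Theorem theorem1p3 (R : realType) (ell : nat) (p : 'I_ell -> nat) (n : nat)
    (rho : mx_representation int [set: prod_Zp p] n) (g : prod_Zp p) (l : nat) :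
  (0 < ell)%N ->
  (forall i, prime (p i)) ->
  injective p ->
  generator [set: prod_Zp p] g ->
  let m := (\prod_(i < ell) p i)%N in
  has_rank (cohomology (semidirect rho) l) (Hcount R m l m (rho g)).
Proof.
move=> _ p_prime _ gen m.
rewrite HcountE; first exact: has_rank_cohomology_count.
by apply: prodn_gt0 => i; apply: prime_gt0.
Qed.
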